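(* A Novikov algebra $A$ over $F$ has an almost faithful irreducible right Novikov module if and only if $A$ is primitive. Moreover, every primitive Novikov algebra is prime.
   Context: $F$ is a field of characteristic different from $2$; all algebras are (not necessarily associative or unital) algebras over $F$. Write $(x,y,z)=(xy)z-x(yz)$. An algebra is a Novikov algebra if it satisfies the identities $(x,y,z)=(y,x,z)$ and $(xy)z=(xz)y$. Right modules. Let $\mathcal N_X$ be the free Novikov algebra over $F$ on countably many generators $X=\{x_1,x_2,\dots\}$. For a vector space $V$ let $T(V)$ be its tensor algebra; a linear map $\varphi:V\to B$ to a unital associative algebra $B$ induces the homomorphism $T(\varphi):T(V)\to B$, $1\mapsto 1$, $v_1\otimes\dots\otimes v_n\mapsto\varphi(v_1)\cdots\varphi(v_n)$. Endomorphisms act on the right: $m(\alpha\beta)=(m\alpha)\beta$. Let $R:\mathcal N_X\to\mathrm{End}(\mathcal N_X)$, $R(f)=R_f$, $gR_f=gf$. Elements of the kernel of $T(R):T(\mathcal N_X)\to\mathrm{End}(\mathcal N_X)$ are called R-identities. For $G(x_1,\dots,x_n)\in T(\mathcal N_X)$ and $a_1,\dots,a_n$ in a Novikov algebra $A$, $G(a_1,\dots,a_n)\in T(A)$ is obtained by substituting $a_i$ for $x_i$. A right (Novikov) representation of $A$ is a linear map $\rho:A\to\mathrm{End}(M)$, $M$ a vector space, such that $T(\rho)(G(a_1,\dots,a_n))=0$ for every R-identity $G$ and all $a_i\in A$. The space $M$ with the action $m\cdot a=m\rho(a)$ is then called a right (Novikov) $A$-module. A right $A$-module $M$ is irreducible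 if it has no nonzero proper submodules and $MA\neq 0$. The quasikernel $K_\rho(A)$ of a representation $\rho$ is the largest two-sided ideal of $A$ contained in the kernel $\mathrm{Ker}_\rho(A)=\{a\in A:\rho(a)=0\}$. A representation (or the corresponding module) is almost faithful if $K_\rho(A)=0$. Modular ideals and primitivity. A right ideal $I\neq A$ of a Novikov algebra $A$ is modular if either there exist $e,f\in A$ such that $a-(a,e,f)\in I$ for every $a\in A$, or $I$ is a two-sided ideal such that $A/I$ is a commutative algebra with a unit. A maximal modular right ideal is a maximal right ideal (maximal among proper right ideals) that is modular. A Novikov algebra is primitive if it has a maximal modular right ideal that contains no nonzero two-sided ideals of $A$. An algebra is prime if for any two of its two-sided ideals $I,J$, $IJ=0$ implies $I=0$ or $J=0$. *)

(* Defs.v *)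
From HB Require Import structures.
From mathcomp Require Import all_boot all_order all_algebra.
From mathcomp Require Import mathcomp_extra boolp classical_sets.
From mathcomp Require Import generic_quotient.

Set Implicit Arguments.
Unset Strict Implicit.
Unset Printing Implicit Defensive.

Import GRing.Theory.

Local Open Scope ring_scope.
Local Open Scope classical_set_scope.
Local Open Scope quotient_scope.

Reserved Notation "x ** y" (at level 40, left associativity).

(* Algebras: a vector space with a bilinear product, not assumed associative  *)
(* or unital. The library's algebras are unital, associative and nonzero, so  *)
(* they cover neither Novikov algebras nor End(M) when M = 0.                 *)

HB.mixin Record Lmodule_isNaAlgebra (F : fieldType) A of GRing.Lmodule F A := {
  namul : A -> A -> A;
  namulDl : left_distributive namul +%R;
  namulDr : right_distributive namul +%R;
  nascaleAl : forall (c : F) (x y : A), namul (c *: x) y = c *: namul x y;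
  nascaleAr : forall (c : F) (x y : A), namul x (c *: y) = c *: namul x y
}.

#[short(type="naAlgType")]
HB.structure Definition NaAlgebra (F : fieldType) :=
  {A of GRing.Lmodule F A & Lmodule_isNaAlgebra F A}.

Notation "x ** y" := (namul x y) : ring_scope.

Definition associator (F : fieldType) (A : naAlgType F) (x y z : A) : A :=
  (x ** y) ** z - x ** (y ** z).

HB.mixin Record NaAlgebra_isNovikov (F : fieldType) A of NaAlgebra F A := {
  associatorC12 : forall x y z : A, associator x y z = associator y x z;
  namulAC : forall x y z : A, (x ** y) ** z = (x ** z) ** y
}.

#[short(type="novikovType")]
HB.structure Definition Novikov (F : fieldType) :=
  {A of NaAlgebra F A & NaAlgebra_isNovikov F A}.

HB.mixin Record NaAlgebra_isUnitalAssoc (F : fieldType) A of NaAlgebra F A := {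
  naone : A;
  namulA : forall x y z : A, x ** (y ** z) = (x ** y) ** z;
  na1mul : forall x : A, naone ** x = x;
  namul1 : forall x : A, x ** naone = x
}.

#[short(type="uaAlgType")]
HB.structure Definition UnitalAssoc (F : fieldType) :=
  {A of NaAlgebra F A & NaAlgebra_isUnitalAssoc F A}.

(* The algebra presented by generators G and relations r : formal expressions *)
(* in the generators, modulo the congruence generated by r and the axioms of  *)
(* an algebra. Both the free Novikov algebra and T(V) are obtained this way.  *)

Section Presentation.
Variables (F : fieldType) (G : Type).

Inductive pterm : Type :=
  | PGen of G
  | PZero
  | PAdd of pterm & pterm
  | POpp of pterm
  | PScale of F & pterm
  | PMul of pterm & pterm.

Variable r : pterm -> pterm -> Prop.

Inductive pcong : pterm -> pterm -> Prop :=
  | pcong_rel s t : r s t -> pcong s t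
  | pcong_refl s : pcong s s
  | pcong_sym s t : pcong s t -> pcong t s
  | pcong_trans t s u : pcong s t -> pcong t u -> pcong s u
  | pcong_add s s' t t' : pcong s s' -> pcong t t' ->
      pcong (PAdd s t) (PAdd s' t')
  | pcong_opp s s' : pcong s s' -> pcong (POpp s) (POpp s')
  | pcong_scale c s s' : pcong s s' -> pcong (PScale c s) (PScale c s')
  | pcong_mul s s' t t' : pcong s s' -> pcong t t' ->
      pcong (PMul s t) (PMul s' t')
  | pcong_addA s t u : pcong (PAdd s (PAdd t u)) (PAdd (PAdd s t) u)
  | pcong_addC s t : pcong (PAdd s t) (PAdd t s)
  | pcong_add0 s : pcong (PAdd PZero s) s
  | pcong_addN s : pcong (PAdd (POpp s) s) PZero
  | pcong_scaleA c d s : pcong (PScale c (PScale d s)) (PScale (c * d) s)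
  | pcong_scale1 s : pcong (PScale 1 s) s
  | pcong_scaleDr c s t :
      pcong (PScale c (PAdd s t)) (PAdd (PScale c s) (PScale c t))
  | pcong_scaleDl c d s :
      pcong (PScale (c + d) s) (PAdd (PScale c s) (PScale d s))
  | pcong_mulDl s t u : pcong (PMul (PAdd s t) u) (PAdd (PMul s u) (PMul t u))
  | pcong_mulDr s t u : pcong (PMul s (PAdd t u)) (PAdd (PMul s t) (PMul s u))
  | pcong_mulZl c s t : pcong (PMul (PScale c s) t) (PScale c (PMul s t))
  | pcong_mulZr c s t : pcong (PMul s (PScale c t)) (PScale c (PMul s t)).

HB.instance Definition _ := gen_eqMixin pterm.
HB.instance Definition _ := gen_choiceMixin pterm.

Definition pcongb (s t : pterm) : bool := `[< pcong s t >].

Lemma pcongb_refl : reflexive pcongb.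
Proof. by move=> s; apply/asboolP/pcong_refl. Qed.

Lemma pcongb_sym : symmetric pcongb.
Proof.
by move=> s t; apply/idP/idP => /asboolP h; apply/asboolP/pcong_sym.
Qed.

Lemma pcongb_trans : transitive pcongb.
Proof.
by move=> t s u /asboolP h1 /asboolP h2; apply/asboolP/(pcong_trans h1 h2).
Qed.

Canonical pcong_equiv := EquivRel pcongb pcongb_refl pcongb_sym pcongb_trans.

Definition presAlg := {eq_quot pcong_equiv}.

HB.instance Definition _ := Choice.on presAlg.
HB.instance Definition _ := EqQuotient.on presAlg.

Definition pclass (t : pterm) : presAlg := \pi_presAlg t.

Lemma pclassP s t : pcong s t <-> pclass s = pclass t.
Proof.
split=> [h|/eqmodP /asboolP //].
by apply/eqmodP/asboolP.
Qed.

Lemma pclass_repr (x : presAlg) : pclass (repr x) = x.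
Proof. exact: reprK. Qed.

Lemma pcong_repr t : pcong (repr (pclass t)) t.
Proof. by apply/pclassP; rewrite pclass_repr. Qed.

Definition padd (x y : presAlg) := pclass (PAdd (repr x) (repr y)).
Definition popp (x : presAlg) := pclass (POpp (repr x)).
Definition pscale (c : F) (x : presAlg) := pclass (PScale c (repr x)).
Definition pmul (x y : presAlg) := pclass (PMul (repr x) (repr y)).

Lemma paddE s t : padd (pclass s) (pclass t) = pclass (PAdd s t).
Proof. by apply/pclassP/pcong_add; apply: pcong_repr. Qed.
Lemma poppE s : popp (pclass s) = pclass (POpp s).
Proof. by apply/pclassP/pcong_opp; apply: pcong_repr. Qed.
Lemma pscaleE c s : pscale c (pclass s) = pclass (PScale c s).
Proof. by apply/pclassP/pcong_scale; apply: pcong_repr. Qed.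
Lemma pmulE s t : pmul (pclass s) (pclass t) = pclass (PMul s t).
Proof. by apply/pclassP/pcong_mul; apply: pcong_repr. Qed.

Let pE := (paddE, poppE, pscaleE, pmulE).

Lemma presAlg_ind (P : presAlg -> Prop) :
  (forall t, P (pclass t)) -> forall x, P x.
Proof. by move=> h x; rewrite -(pclass_repr x). Qed.

Lemma paddA : associative padd.
Proof.
elim/presAlg_ind=> s; elim/presAlg_ind=> t; elim/presAlg_ind=> u.
by rewrite !pE; apply/pclassP/pcong_addA.
Qed.
Lemma paddC : commutative padd.
Proof.
elim/presAlg_ind=> s; elim/presAlg_ind=> t.
by rewrite !pE; apply/pclassP/pcong_addC.
Qed.
Lemma padd0 : left_id (pclass PZero) padd.
Proof. by elim/presAlg_ind=> s; rewrite !pE; apply/pclassP/pcong_add0. Qed.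
Lemma paddN : left_inverse (pclass PZero) popp padd.
Proof. by elim/presAlg_ind=> s; rewrite !pE; apply/pclassP/pcong_addN. Qed.

HB.instance Definition _ := GRing.isZmodule.Build presAlg paddA paddC padd0 paddN.

Lemma pscaleA c d (x : presAlg) : pscale c (pscale d x) = pscale (c * d) x.
Proof.
by elim/presAlg_ind: x => s; rewrite !pE; apply/pclassP/pcong_scaleA.
Qed.
Lemma pscale1 : left_id 1 pscale.
Proof. by elim/presAlg_ind=> s; rewrite !pE; apply/pclassP/pcong_scale1. Qed.
Lemma pscaleDr : right_distributive pscale +%R.
Proof.
move=> c; elim/presAlg_ind=> s; elim/presAlg_ind=> t.
by rewrite /GRing.add /= !pE; apply/pclassP/pcong_scaleDr.
Qed.
Lemma pscaleDl (x : presAlg) : {morph pscale^~ x : c d / c + d}.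
Proof.
move=> c d; elim/presAlg_ind: x => s.
by rewrite {2}/GRing.add /= !pE; apply/pclassP/pcong_scaleDl.
Qed.

HB.instance Definition _ :=
  GRing.Zmodule_isLmodule.Build F presAlg pscaleA pscale1 pscaleDr pscaleDl.

Lemma pclassD s t : pclass (PAdd s t) = pclass s + pclass t.
Proof. by rewrite -paddE. Qed.
Lemma pclassN s : pclass (POpp s) = - pclass s.
Proof. by rewrite -poppE. Qed.
Lemma pclassZ c s : pclass (PScale c s) = c *: pclass s.
Proof. by rewrite -pscaleE. Qed.

Lemma pmulDl : left_distributive pmul +%R.
Proof.
elim/presAlg_ind=> s; elim/presAlg_ind=> t; elim/presAlg_ind=> u.
by rewrite !(pE, =^~ pclassD); apply/pclassP/pcong_mulDl.
Qed.
Lemma pmulDr : right_distributive pmul +%R.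
Proof.
elim/presAlg_ind=> s; elim/presAlg_ind=> t; elim/presAlg_ind=> u.
by rewrite !(pE, =^~ pclassD); apply/pclassP/pcong_mulDr.
Qed.
Lemma pmulZl c x y : pmul (c *: x) y = c *: pmul x y.
Proof.
elim/presAlg_ind: x => s; elim/presAlg_ind: y => t.
by rewrite -pclassZ !pmulE -pclassZ; apply/pclassP/pcong_mulZl.
Qed.
Lemma pmulZr c x y : pmul x (c *: y) = c *: pmul x y.
Proof.
elim/presAlg_ind: x => s; elim/presAlg_ind: y => t.
by rewrite -pclassZ !pmulE -pclassZ; apply/pclassP/pcong_mulZr.
Qed.

HB.instance Definition _ :=
  Lmodule_isNaAlgebra.Build F presAlg pmulDl pmulDr pmulZl pmulZr.

Lemma pclassM s t : pclass (PMul s t) = pclass s ** pclass t.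
Proof. by rewrite -pmulE. Qed.

Section Lift.
Variables (B : naAlgType F) (f : G -> B).

Fixpoint peval (t : pterm) : B :=
  match t with
  | PGen g => f g
  | PZero => 0
  | PAdd s t => peval s + peval t
  | POpp s => - peval s
  | PScale c s => c *: peval s
  | PMul s t => peval s ** peval t
  end.

(* The homomorphism extending f; see [plift_class] for the condition that     *)
(* makes it independent of the representative.                                *)
Definition plift (x : presAlg) : B := peval (repr x).

Hypothesis fr : forall s t, r s t -> peval s = peval t.

Lemma peval_cong s t : pcong s t -> peval s = peval t.
Proof.
elim=> {s t} //=.
- by move=> t s u _ -> _ ->.
- by move=> s s' t t' _ -> _ ->.
- by move=> s s' _ ->.
- by move=> c s s' _ ->.
- by move=> s s' t t' _ -> _ ->.
- by move=> s t u; rewrite addrA.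
- by move=> s t; rewrite addrC.
- by move=> s; rewrite add0r.
- by move=> s; rewrite addNr.
- by move=> c d s; rewrite scalerA.
- by move=> s; rewrite scale1r.
- by move=> c s t; rewrite scalerDr.
- by move=> c d s; rewrite scalerDl.
- by move=> s t u; rewrite namulDl.
- by move=> s t u; rewrite namulDr.
- by move=> c s t; rewrite nascaleAl.
- by move=> c s t; rewrite nascaleAr.
Qed.

Lemma plift_class t : plift (pclass t) = peval t.
Proof. by apply: peval_cong; apply: pcong_repr. Qed.

Lemma plift_linear : linear plift.
Proof.
move=> c; elim/presAlg_ind=> s; elim/presAlg_ind=> t.
by rewrite -pclassZ -pclassD !plift_class.
Qed.

Lemma pliftM x y : plift (x ** y) = plift x ** plift y.
Proof.
elim/presAlg_ind: x => s; elim/presAlg_ind: y => t.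
by rewrite -pclassM !plift_class.
Qed.

Lemma plift_unique (h : {linear presAlg -> B}) :
  (forall x y, h (x ** y) = h x ** h y) ->
  (forall g, h (pclass (PGen g)) = f g) -> h =1 plift.
Proof.
move=> hM hG; elim/presAlg_ind=> t; rewrite plift_class.
elim: t => [g||s IHs t IHt|s IHs|c s IHs|s IHs t IHt] /=.
- exact: hG.
- have -> : pclass PZero = 0 by [].
  by rewrite raddf0.
- rewrite pclassD -IHs -IHt; exact: linearD.
- rewrite pclassN -IHs; exact: linearN.
- rewrite pclassZ -IHs; exact: linearZ_LR.
- by rewrite pclassM hM IHs IHt.
Qed.

End Lift.
End Presentation.

Arguments PZero {F G}.
Arguments PGen {F G} _.

(* The free Novikov algebra; the generators x_1, x_2, ... are indexed by nat. *)

Section FreeNovikov.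
Variable F : fieldType.

Inductive novikov_rel : pterm F nat -> pterm F nat -> Prop :=
  | nrel_assoc x y z : novikov_rel
      (PAdd (PMul (PMul x y) z) (POpp (PMul x (PMul y z))))
      (PAdd (PMul (PMul y x) z) (POpp (PMul y (PMul x z))))
  | nrel_mulAC x y z : novikov_rel (PMul (PMul x y) z) (PMul (PMul x z) y).

Definition freeNovikov := presAlg novikov_rel.

HB.instance Definition _ := NaAlgebra.on freeNovikov.

Lemma freeNovikov_assoc (x y z : freeNovikov) :
  associator x y z = associator y x z.
Proof.
elim/presAlg_ind: x => x; elim/presAlg_ind: y => y; elim/presAlg_ind: z => z.
rewrite /associator -(pclassM _ x y) -(pclassM _ y x) -(pclassM _ y z).
rewrite -(pclassM _ x z) -!(pclassM _ (PMul _ _)) -!(pclassM _ _ (PMul _ _)).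
rewrite -!pclassN -!pclassD.
by apply/pclassP/pcong_rel/nrel_assoc.
Qed.

Lemma freeNovikov_mulAC (x y z : freeNovikov) : (x ** y) ** z = (x ** z) ** y.
Proof.
elim/presAlg_ind: x => x; elim/presAlg_ind: y => y; elim/presAlg_ind: z => z.
rewrite -(pclassM _ x y) -(pclassM _ x z) -!(pclassM _ (PMul _ _)).
by apply/pclassP/pcong_rel/nrel_mulAC.
Qed.

HB.instance Definition _ :=
  NaAlgebra_isNovikov.Build F freeNovikov freeNovikov_assoc freeNovikov_mulAC.

Definition novX (i : nat) : freeNovikov := pclass novikov_rel (PGen i).

(* The substitution x_i := a i. *)
Definition nsubst (A : novikovType F) (a : nat -> A) : freeNovikov -> A :=
  plift a.

Section Subst.
Variables (A : novikovType F) (a : nat -> A).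

Lemma nsubst_rel s t : novikov_rel s t -> peval a s = peval a t.
Proof. by case=> x y z /=; [exact: associatorC12 | exact: namulAC]. Qed.

Lemma nsubstX i : nsubst a (novX i) = a i.
Proof. exact: (plift_class nsubst_rel). Qed.

Lemma nsubstM x y : nsubst a (x ** y) = nsubst a x ** nsubst a y.
Proof. exact: (pliftM nsubst_rel). Qed.

HB.instance Definition _ := GRing.isLinear.Build F freeNovikov A *:%R (nsubst a)
  (plift_linear nsubst_rel).

Lemma nsubst_unique (h : {linear freeNovikov -> A}) :
  (forall x y, h (x ** y) = h x ** h y) ->
  (forall i, h (novX i) = a i) -> h =1 nsubst a.
Proof. exact: (plift_unique nsubst_rel). Qed.

End Subst.
End FreeNovikov.

(* The tensor algebra T(V), presented by the vectors of V and a unit: it is   *)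
(* the unital associative algebra universal among those receiving a linear    *)
(* map from V ([tlift], [tlift_unique]).                                      *)

Section Tensor.
Variables (F : fieldType) (V : lmodType F).

Inductive tgen : Type := TOne | TVec of V.

Inductive tensor_rel : pterm F tgen -> pterm F tgen -> Prop :=
  | trel_assoc x y z : tensor_rel (PMul x (PMul y z)) (PMul (PMul x y) z)
  | trel_1mul x : tensor_rel (PMul (PGen TOne) x) x
  | trel_mul1 x : tensor_rel (PMul x (PGen TOne)) x
  | trel_linear c u v : tensor_rel (PGen (TVec (c *: u + v)))
      (PAdd (PScale c (PGen (TVec u))) (PGen (TVec v))).

Definition tensor := presAlg tensor_rel.

HB.instance Definition _ := NaAlgebra.on tensor.

Definition tone : tensor := pclass tensor_rel (PGen TOne).

Lemma tensor_mulA (x y z : tensor) : x ** (y ** z) = (x ** y) ** z.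
Proof.
elim/presAlg_ind: x => x; elim/presAlg_ind: y => y; elim/presAlg_ind: z => z.
rewrite -(pclassM _ x y) -(pclassM _ y z).
rewrite -(pclassM _ (PMul _ _)) -(pclassM _ _ (PMul _ _)).
by apply/pclassP/pcong_rel/trel_assoc.
Qed.

Lemma tensor_1mul (x : tensor) : tone ** x = x.
Proof.
elim/presAlg_ind: x => x.
by rewrite -!pclassM; apply/pclassP/pcong_rel/trel_1mul.
Qed.

Lemma tensor_mul1 (x : tensor) : x ** tone = x.
Proof.
elim/presAlg_ind: x => x.
by rewrite -!pclassM; apply/pclassP/pcong_rel/trel_mul1.
Qed.

HB.instance Definition _ :=
  NaAlgebra_isUnitalAssoc.Build F tensor tensor_mulA tensor_1mul tensor_mul1.

Definition tvec (v : V) : tensor := pclass tensor_rel (PGen (TVec v)).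

Lemma tvec_linear : linear tvec.
Proof.
move=> c u v; rewrite /tvec -pclassZ -pclassD.
by apply/pclassP/pcong_rel/trel_linear.
Qed.

HB.instance Definition _ := GRing.isLinear.Build F V tensor *:%R tvec tvec_linear.

Section Lift.
Variables (B : uaAlgType F) (phi : {linear V -> B}).

Definition tgen_eval (g : tgen) : B :=
  match g with TOne => naone | TVec v => phi v end.

(* The map written T(phi) : T(V) -> B in the literature. *)
Definition tlift : tensor -> B := plift tgen_eval.

Lemma tlift_rel s t : tensor_rel s t -> peval tgen_eval s = peval tgen_eval t.
Proof.
case=> [x y z|x|x|c u v] /=.
- exact: namulA.
- exact: na1mul.
- exact: namul1.
- by rewrite linearP.
Qed.

Lemma tlift1 : tlift naone = naone.
Proof. exact: (plift_class tlift_rel). Qed.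

Lemma tlift_vec v : tlift (tvec v) = phi v.
Proof. exact: (plift_class tlift_rel). Qed.

Lemma tliftM x y : tlift (x ** y) = tlift x ** tlift y.
Proof. exact: (pliftM tlift_rel). Qed.

HB.instance Definition _ := GRing.isLinear.Build F tensor B *:%R tlift
  (plift_linear tlift_rel).

Lemma tlift_unique (h : {linear tensor -> B}) :
  h naone = naone -> (forall x y, h (x ** y) = h x ** h y) ->
  (forall v, h (tvec v) = phi v) -> h =1 tlift.
Proof. by move=> h1 hM hv; apply: (plift_unique tlift_rel hM) => -[]. Qed.

End Lift.
End Tensor.

(* End(M), with endomorphisms acting on the right: m (f g) = (m f) g. *)

Section Endomorphisms.
Variables (F : fieldType) (M : lmodType F).

Definition endo := {linear M -> M}.

HB.instance Definition _ := gen_eqMixin endo.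
HB.instance Definition _ := gen_choiceMixin endo.

Lemma endoP (f g : endo) : (forall m, f m = g m) -> f = g.
Proof.
case: f g => [f cf] [g cg] /= fg.
have {}fg : f = g by apply/funext.
move: cf cg; rewrite fg.
move=> [[a] [b]] [[a'] [b']].
by rewrite (Prop_irrelevance a a') (Prop_irrelevance b b').
Qed.

Definition endo0 : endo := \0.
Definition endo_add (f g : endo) : endo := f \+ g.
Definition endo_opp (f : endo) : endo := \- f.
Definition endo_scale (c : F) (f : endo) : endo := c \*: f.
Definition endo_mul (f g : endo) : endo := g \o f.
Definition endo1 : endo := idfun.

Fact endo_addA : associative endo_add.
Proof. by move=> f g h; apply: endoP => m /=; rewrite addrA. Qed.
Fact endo_addC : commutative endo_add.
Proof. by move=> f g; apply: endoP => m /=; rewrite addrC. Qed.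
Fact endo_add0 : left_id endo0 endo_add.
Proof. by move=> f; apply: endoP => m /=; rewrite add0r. Qed.
Fact endo_addN : left_inverse endo0 endo_opp endo_add.
Proof. by move=> f; apply: endoP => m /=; rewrite addNr. Qed.

HB.instance Definition _ :=
  GRing.isZmodule.Build endo endo_addA endo_addC endo_add0 endo_addN.

Fact endo_scaleA c d f : endo_scale c (endo_scale d f) = endo_scale (c * d) f.
Proof. by apply: endoP => m /=; rewrite scalerA. Qed.
Fact endo_scale1 : left_id 1 endo_scale.
Proof. by move=> f; apply: endoP => m /=; rewrite scale1r. Qed.
Fact endo_scaleDr : right_distributive endo_scale +%R.
Proof. by move=> c f g; apply: endoP => m /=; rewrite scalerDr. Qed.
Fact endo_scaleDl f : {morph endo_scale^~ f : c d / c + d}.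
Proof. by move=> c d; apply: endoP => m /=; rewrite scalerDl. Qed.

HB.instance Definition _ := GRing.Zmodule_isLmodule.Build F endo
  endo_scaleA endo_scale1 endo_scaleDr endo_scaleDl.

Fact endo_mulDl : left_distributive endo_mul +%R.
Proof. by move=> f g h; apply: endoP => m /=; rewrite linearD. Qed.
Fact endo_mulDr : right_distributive endo_mul +%R.
Proof. by move=> f g h; apply: endoP. Qed.
Fact endo_mulZl c f g : endo_mul (c *: f) g = c *: endo_mul f g.
Proof. by apply: endoP => m /=; rewrite linearZ_LR. Qed.
Fact endo_mulZr c f g : endo_mul f (c *: g) = c *: endo_mul f g.
Proof. by apply: endoP. Qed.

HB.instance Definition _ := Lmodule_isNaAlgebra.Build F endo
  endo_mulDl endo_mulDr endo_mulZl endo_mulZr.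

Fact endo_mulA (f g h : endo) : f ** (g ** h) = (f ** g) ** h.
Proof. exact: endoP. Qed.
Fact endo_1mul (f : endo) : endo1 ** f = f.
Proof. exact: endoP. Qed.
Fact endo_mul1 (f : endo) : f ** endo1 = f.
Proof. exact: endoP. Qed.

HB.instance Definition _ := NaAlgebra_isUnitalAssoc.Build F endo
  endo_mulA endo_1mul endo_mul1.

End Endomorphisms.

Section RightMultiplication.
Variables (F : fieldType) (A : naAlgType F).

Definition rmul_fun (f g : A) : A := g ** f.

Fact rmul_fun_linear f : linear (rmul_fun f).
Proof. by move=> c x y; rewrite /rmul_fun namulDl nascaleAl. Qed.

HB.instance Definition _ f :=
  GRing.isLinear.Build F A A *:%R (rmul_fun f) (rmul_fun_linear f).

Definition rmul (f : A) : endo A := rmul_fun f.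

Fact rmul_linear : linear rmul.
Proof.
move=> c f g; apply: endoP => x /=.
by rewrite /rmul_fun namulDr nascaleAr.
Qed.

HB.instance Definition _ :=
  GRing.isLinear.Build F A (endo A) *:%R rmul rmul_linear.

End RightMultiplication.

Section Ideals.
Variables (F : fieldType).

Definition subspace (V : lmodType F) (S : set V) : Prop :=
  S 0 /\ forall (c : F) (x y : V), S x -> S y -> S (c *: x + y).

Variable A : naAlgType F.

Definition right_ideal (I : set A) : Prop :=
  subspace I /\ forall x a, I x -> I (x ** a).

Definition two_sided_ideal (I : set A) : Prop :=
  right_ideal I /\ forall x a, I x -> I (a ** x).

(* IJ is spanned by the products x ** y, so IJ = 0 iff they all vanish. *)
Definition prime_algebra : Prop :=
  forall I J : set A, two_sided_ideal I -> two_sided_ideal J ->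
    (forall x y, I x -> J y -> x ** y = 0) -> I = [set 0] \/ J = [set 0].

End Ideals.

Section QuotientAlgebra.
Variables (F : fieldType) (A : naAlgType F) (I : set A).
Hypothesis hI : two_sided_ideal I.

Let I0 : I 0. Proof. by case: hI => -[[]]. Qed.
Let IZ c x : I x -> I (c *: x).
Proof. by move=> Ix; rewrite -[_ *: _]addr0; case: hI => -[[_ +] _] _; apply. Qed.
Let ID x y : I x -> I y -> I (x + y).
Proof. by move=> Ix; rewrite -[x]scale1r; case: hI => -[[_ +] _] _; apply. Qed.
Let IN x : I x -> I (- x).
Proof. by rewrite -scaleN1r; apply: IZ. Qed.
Let IMr x a : I x -> I (x ** a).
Proof. by case: hI => -[_ +] _; apply. Qed.
Let IMl x a : I x -> I (a ** x).
Proof. by case: hI => _; apply. Qed.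

Definition ideal_eqb (x y : A) : bool := `[< I (x - y) >].

Fact ideal_eqb_refl : reflexive ideal_eqb.
Proof. by move=> x; apply/asboolP; rewrite subrr. Qed.
Fact ideal_eqb_sym : symmetric ideal_eqb.
Proof.
by move=> x y; apply/idP/idP => /asboolP h; apply/asboolP; rewrite -opprB; apply: IN.
Qed.
Fact ideal_eqb_trans : transitive ideal_eqb.
Proof.
move=> y x z /asboolP h1 /asboolP h2; apply/asboolP.
by rewrite -(subrKA y); apply: ID.
Qed.

Canonical ideal_equiv :=
  EquivRel ideal_eqb ideal_eqb_refl ideal_eqb_sym ideal_eqb_trans.

Definition quotAlg := {eq_quot ideal_equiv}.

HB.instance Definition _ := Choice.on quotAlg.
HB.instance Definition _ := EqQuotient.on quotAlg.

Definition qclass (x : A) : quotAlg := \pi_quotAlg x.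

Lemma qclassP x y : I (x - y) <-> qclass x = qclass y.
Proof.
split=> [h|/eqmodP /asboolP //].
by apply/eqmodP/asboolP.
Qed.

Lemma qclass_repr (u : quotAlg) : qclass (repr u) = u.
Proof. exact: reprK. Qed.

Let I_repr x : I (repr (qclass x) - x).
Proof. by apply/qclassP; rewrite qclass_repr. Qed.

Definition qadd (u v : quotAlg) := qclass (repr u + repr v).
Definition qopp (u : quotAlg) := qclass (- repr u).
Definition qscale (c : F) (u : quotAlg) := qclass (c *: repr u).
Definition qmul (u v : quotAlg) := qclass (repr u ** repr v).

Let namulBl (x y z : A) : (x - y) ** z = x ** z - y ** z.
Proof. by rewrite namulDl -scaleN1r nascaleAl scaleN1r. Qed.
Let namulBr (x y z : A) : x ** (y - z) = x ** y - x ** z.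
Proof. by rewrite namulDr -scaleN1r nascaleAr scaleN1r. Qed.

Fact qaddE x y : qadd (qclass x) (qclass y) = qclass (x + y).
Proof. by apply/qclassP; rewrite opprD addrACA; apply: ID. Qed.
Fact qoppE x : qopp (qclass x) = qclass (- x).
Proof. by apply/qclassP; rewrite -opprD; apply: IN. Qed.
Fact qscaleE c x : qscale c (qclass x) = qclass (c *: x).
Proof. by apply/qclassP; rewrite -scalerBr; apply: IZ. Qed.
Fact qmulE x y : qmul (qclass x) (qclass y) = qclass (x ** y).
Proof.
apply/qclassP; rewrite -(subrKA (x ** repr (qclass y))).
by apply: ID; rewrite -?namulBl -?namulBr; [apply: IMr | apply: IMl].
Qed.

Let qE := (qaddE, qoppE, qscaleE, qmulE).

Lemma quotAlg_ind (P : quotAlg -> Prop) :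
  (forall x, P (qclass x)) -> forall u, P u.
Proof. by move=> h u; rewrite -(qclass_repr u). Qed.

Fact qaddA : associative qadd.
Proof.
elim/quotAlg_ind=> x; elim/quotAlg_ind=> y; elim/quotAlg_ind=> z.
by rewrite !qE addrA.
Qed.
Fact qaddC : commutative qadd.
Proof. by elim/quotAlg_ind=> x; elim/quotAlg_ind=> y; rewrite !qE addrC. Qed.
Fact qadd0 : left_id (qclass 0) qadd.
Proof. by elim/quotAlg_ind=> x; rewrite !qE add0r. Qed.
Fact qaddN : left_inverse (qclass 0) qopp qadd.
Proof. by elim/quotAlg_ind=> x; rewrite !qE addNr. Qed.

HB.instance Definition _ := GRing.isZmodule.Build quotAlg qaddA qaddC qadd0 qaddN.

Lemma qclassD x y : qclass (x + y) = qclass x + qclass y.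
Proof. by rewrite -qaddE. Qed.

Fact qscaleA c d (u : quotAlg) : qscale c (qscale d u) = qscale (c * d) u.
Proof. by elim/quotAlg_ind: u => x; rewrite !qE scalerA. Qed.
Fact qscale1 : left_id 1 qscale.
Proof. by elim/quotAlg_ind=> x; rewrite !qE scale1r. Qed.
Fact qscaleDr : right_distributive qscale +%R.
Proof.
move=> c; elim/quotAlg_ind=> x; elim/quotAlg_ind=> y.
by rewrite !(qE, =^~ qclassD) scalerDr.
Qed.
Fact qscaleDl (u : quotAlg) : {morph qscale^~ u : c d / c + d}.
Proof.
move=> c d; elim/quotAlg_ind: u => x.
by rewrite !(qE, =^~ qclassD) scalerDl.
Qed.

HB.instance Definition _ :=
  GRing.Zmodule_isLmodule.Build F quotAlg qscaleA qscale1 qscaleDr qscaleDl.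

Lemma qclassZ c x : qclass (c *: x) = c *: qclass x.
Proof. by rewrite -qscaleE. Qed.

Fact qmulDl : left_distributive qmul +%R.
Proof.
elim/quotAlg_ind=> x; elim/quotAlg_ind=> y; elim/quotAlg_ind=> z.
by rewrite !(qE, =^~ qclassD) namulDl.
Qed.
Fact qmulDr : right_distributive qmul +%R.
Proof.
elim/quotAlg_ind=> x; elim/quotAlg_ind=> y; elim/quotAlg_ind=> z.
by rewrite !(qE, =^~ qclassD) namulDr.
Qed.
Fact qmulZl c u v : qmul (c *: u) v = c *: qmul u v.
Proof.
elim/quotAlg_ind: u => x; elim/quotAlg_ind: v => y.
by rewrite -qclassZ !qmulE -qclassZ nascaleAl.
Qed.
Fact qmulZr c u v : qmul u (c *: v) = c *: qmul u v.
Proof.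
elim/quotAlg_ind: u => x; elim/quotAlg_ind: v => y.
by rewrite -qclassZ !qmulE -qclassZ nascaleAr.
Qed.

HB.instance Definition _ :=
  Lmodule_isNaAlgebra.Build F quotAlg qmulDl qmulDr qmulZl qmulZr.

Lemma qclassM x y : qclass (x ** y) = qclass x ** qclass y.
Proof. by rewrite -qmulE. Qed.

End QuotientAlgebra.

Section Primitive.
Variables (F : fieldType).

Definition commutative_algebra (A : naAlgType F) : Prop :=
  forall x y : A, x ** y = y ** x.

Definition has_unit (A : naAlgType F) : Prop :=
  exists u : A, forall x : A, u ** x = x /\ x ** u = x.

Variable A : novikovType F.

Definition modular (I : set A) : Prop :=
  [/\ right_ideal I, I <> setT &
      (exists e f : A, forall a : A, I (a - associator a e f)) \/
      (exists hI : two_sided_ideal I,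
         commutative_algebra (quotAlg hI) /\ has_unit (quotAlg hI))].

Definition maximal_right_ideal (I : set A) : Prop :=
  [/\ right_ideal I, I <> setT &
      forall J : set A, right_ideal J -> J <> setT -> I `<=` J -> J = I].

Definition primitive : Prop :=
  exists I : set A,
    [/\ maximal_right_ideal I, modular I &
        forall J : set A, two_sided_ideal J -> J `<=` I -> J = [set 0]].

End Primitive.

Section Representations.
Variables (F : fieldType).

Definition R_identity (G : tensor (freeNovikov F)) : Prop :=
  tlift (@rmul F (freeNovikov F)) G = 0.

Variable A : novikovType F.

(* G(a_0, a_1, ...), the image of G under T(N_X) -> T(A). *)
Definition tsubst (a : nat -> A) : tensor (freeNovikov F) -> tensor A :=
  tlift (@tvec F A \o nsubst a).

Variables (M : lmodType F) (rho : {linear A -> endo M}).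

Definition right_representation : Prop :=
  forall G, R_identity G -> forall a : nat -> A, tlift rho (tsubst a G) = 0.

Definition submodule (N : set M) : Prop :=
  subspace N /\ forall m a, N m -> N (rho a m).

(* The second conjunct is MA <> 0. *)
Definition irreducible : Prop :=
  (forall N : set M, submodule N -> N = [set 0] \/ N = setT) /\
  (exists m a, rho a m <> 0).

Definition rep_kernel : set A := [set a | rho a = 0].

(* The union of all two-sided ideals inside the kernel; by [quasikernel_ideal]*)
(* it is itself such an ideal, hence the largest one.                         *)
Definition quasikernel : set A :=
  [set a | exists I : set A, [/\ two_sided_ideal I, I `<=` rep_kernel & I a]].

Lemma quasikernel_ideal :
  two_sided_ideal quasikernel /\ quasikernel `<=` rep_kernel.
Proof.
split; last by move=> a [I [_ IK Ia]]; apply: IK.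
split; last first.
  move=> x a [I [hI IK Ix]]; exists I; split=> //.
  by case: hI => _; apply.
split; last first.
  move=> x a [I [hI IK Ix]]; exists I; split=> //.
  by case: hI => -[_ +] _; apply.
split.
  exists [set 0]; split=> //; last by move=> _ ->; exact: linear0.
  have mul0l (x : A) : 0 ** x = 0 by rewrite -(scale0r x) nascaleAl !scale0r.
  have mul0r (x : A) : x ** 0 = 0 by rewrite -(scale0r x) nascaleAr !scale0r.
  split; last by move=> x a ->; apply: mul0r.
  split; last by move=> x a ->; apply: mul0l.
  by split=> // c x y -> ->; rewrite scaler0 addr0.
move=> c x y [I [hI IK Ix]] [J [hJ JK Jy]].
have [[[I0 ID] IMr] IMl] := hI; have [[[J0 JD] JMr] JMl] := hJ.
exists [set u + v | u in I & v in J]; split; last first.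
- exists (c *: x); last by exists y.
  by rewrite -[_ *: _]addr0; apply: ID.
- move=> _ [u Iu [v Jv <-]]; rewrite /rep_kernel /= linearD.
  by rewrite (IK _ Iu) (JK _ Jv) addr0.
split; last first.
  move=> _ a [u Iu [v Jv <-]]; exists (a ** u); first exact: IMl.
  by exists (a ** v); [exact: JMl | rewrite namulDr].
split; last first.
  move=> _ a [u Iu [v Jv <-]]; exists (u ** a); first exact: IMr.
  by exists (v ** a); [exact: JMr | rewrite namulDl].
split; first by exists 0 => //; exists 0 => //; rewrite addr0.
move=> d _ _ [u Iu [v Jv <-]] [u' Iu' [v' Jv' <-]].
exists (d *: u + u'); first exact: ID.
by exists (d *: v + v'); [exact: JD | rewrite scalerDr addrACA].
Qed.

Lemma quasikernel_max (I : set A) :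
  two_sided_ideal I -> I `<=` rep_kernel -> I `<=` quasikernel.
Proof. by move=> hI IK a Ia; exists I. Qed.

Definition almost_faithful : Prop := quasikernel = [set 0].

End Representations.

(* Main.v *)
(* If M is irreducible and B(x,y) = rho(xy) - rho(x)rho(y) is not zero, then *)
(* B(xz,y) = B(x,y)rho(z) is an R-identity, so x |-> m B(x,y) is a module     *)
(* morphism from A onto M for suitable m, y. Its kernel I is modular: if      *)
(* m B(e,y) = -m, then a - (a,e,y) lies in I. If B = 0, the morphism          *)
(* x |-> m rho(x) has an ideal as kernel, with commutative unital quotient.   *)
(* Either kernel contains no nonzero ideal J, since AJ <= I gives MJ = 0.     *)
(* Conversely, for a maximal modular right ideal P with zero core, an ideal J *)
(* with AJ <= P is contained in P, because (a,e,f) = (e,a,f), hence is zero;  *)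
(* this makes A/P almost faithful. If IJ = 0 and I is not in P, then          *)
(* A = I + P and AJ <= P, so J = 0.                                           *)
Require Import Defs.
From HB Require Import structures.
From mathcomp Require Import all_boot all_order all_algebra.
From mathcomp Require Import boolp classical_sets.

Set Implicit Arguments.
Unset Strict Implicit.
Unset Printing Implicit Defensive.

Import GRing.Theory.

Local Open Scope ring_scope.
Local Open Scope classical_set_scope.

(** [R_identity_defect] makes [defect y m], the map x |-> m B(x,y), a module morphism from A to M.
    Any nonzero morphism onto an irreducible M is handled by [irreducible_surj], [maximal_ker] and
    [ideal_in_ker], so [irreducible_primitive] only has to check that its kernel is modular, by
    [defect_associator] or, when B = 0, by commutativity. Conversely, [right_representation_image]
    shows that A/P inherits every R-identity from right multiplication in A, and [mul_ideal_modular]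
    supplies the nonzero action, almost faithfulness and primeness. *)

Section Products.
Variables (F : fieldType) (A : naAlgType F).
Implicit Types x y z : A.

Lemma namulBl x y z : (x - y) ** z = x ** z - y ** z.
Proof. by rewrite namulDl -scaleN1r nascaleAl scaleN1r. Qed.

End Products.

Section Subspaces.
Variables (F : fieldType) (V : lmodType F) (S : set V).
Hypothesis hS : subspace S.

Lemma subspaceZ c x : S x -> S (c *: x).
Proof. by case: hS => S0 SP Sx; rewrite -[_ *: _]addr0; apply: SP. Qed.

Lemma subspaceD x y : S x -> S y -> S (x + y).
Proof. by case: hS => _ SP Sx; rewrite -[x]scale1r; apply: SP. Qed.

Lemma subspaceB x y : S x -> S y -> S (x - y).
Proof.
by move=> Sx Sy; apply: subspaceD => //; rewrite -scaleN1r; apply: subspaceZ.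
Qed.

End Subspaces.

Lemma two_sided_idealT (F : fieldType) (A : naAlgType F) :
  two_sided_ideal [set: A].
Proof. by []. Qed.

(** * Substitution into R-identities and transport to modules *)

Section FiniteDependence.
Variables (F : fieldType) (C : Type).

Definition agree (n : nat) (a a' : nat -> C) :=
  forall i, (i < n)%N -> a i = a' i.

Definition finitely_determined (D : Type) (f : (nat -> C) -> D) :=
  exists n, forall a a', agree n a a' -> f a = f a'.

Lemma peval_finitely_determined (G : Type) (B : naAlgType F)
    (f : (nat -> C) -> G -> B) (t : pterm F G) :
  (forall g, finitely_determined (f^~ g)) ->
  finitely_determined (fun a => peval (f a) t).
Proof.
move=> fP; elim: t => /=
  [g||s [n sP] t [m tP]|s [n sP]|c s [n sP]|s [n sP] t [m tP]].
- exact: fP.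
- by exists 0%N.
- exists (maxn n m) => a a' aa'; rewrite (sP _ a') ?(tP _ a') // => i lt_i.
  + by apply: aa'; rewrite leq_max lt_i orbT.
  + by apply: aa'; rewrite leq_max lt_i.
- by exists n => a a' /sP ->.
- by exists n => a a' /sP ->.
- exists (maxn n m) => a a' aa'; rewrite (sP _ a') ?(tP _ a') // => i lt_i.
  + by apply: aa'; rewrite leq_max lt_i orbT.
  + by apply: aa'; rewrite leq_max lt_i.
Qed.

End FiniteDependence.

Section Substitution.
Variables (F : fieldType) (A : novikovType F).

Lemma nsubst_finitely_determined (g : freeNovikov F) :
  finitely_determined (fun a : nat -> A => nsubst a g).
Proof.
elim/presAlg_ind: g => t.
have [|n nP] := @peval_finitely_determined F A nat A id t.
  by move=> i; exists i.+1 => a a'; apply.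
by exists n => a a' /nP e; rewrite /nsubst !(plift_class (@nsubst_rel _ _ _)).
Qed.

(** A representative of G involves finitely many elements of N_X, and each of these involves
    finitely many x_i. *)
Lemma tsubst_finitely_determined (G : tensor (freeNovikov F)) :
  finitely_determined (fun a : nat -> A => tsubst a G).
Proof.
elim/presAlg_ind: G => t.
have [|n nP] := @peval_finitely_determined F A _ (tensor A)
    (fun a => tgen_eval (@tvec F A \o nsubst a)) t.
  case=> [|v]; first by exists 0%N.
  by have [n nP] := nsubst_finitely_determined v; exists n => a a' /nP /= ->.
exists n => a a' /nP e.
by rewrite /tsubst /tlift !(plift_class (@tlift_rel _ _ _ _)).
Qed.

End Substitution.

Section Intertwining.
Variables (F : fieldType) (V W M N : lmodType F).
Variables (rho : {linear V -> endo M}) (sigma : {linear W -> endo N}).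
Variables (h : {linear V -> W}) (f : {linear M -> N}).
Hypothesis fh : forall v m, f (rho v m) = sigma (h v) (f m).

Lemma tlift_intertwine (t : tensor V) (m : M) :
  f (tlift rho t m) = tlift sigma (tlift (@tvec F W \o h) t) (f m).
Proof.
elim/presAlg_ind: t m => t.
rewrite /(tlift rho) /(tlift (_ \o _)) !(plift_class (@tlift_rel _ _ _ _)).
elim: t => /= [[|v]||s IHs t IHt|s IHs|c s IHs|s IHs t IHt] m.
- by rewrite tlift1.
- by rewrite tlift_vec fh.
- by rewrite !linear0.
- by rewrite !linearD /= IHs IHt.
- by rewrite !linearN /= IHs.
- by rewrite !linearZ /= IHs.
- by rewrite tliftM /= IHt IHs.
Qed.

End Intertwining.

(* An R-identity uses finitely many of the x_i, so one can substitute an      *)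
(* arbitrary element for a variable that does not occur in it and apply the   *)
(* identity to that variable.                                                 *)
Lemma right_representation_image (F : fieldType) (A : novikovType F)
    (M : lmodType F) (rho : {linear A -> endo M}) (f : {linear A -> M}) :
  (forall x a, f (x ** a) = rho a (f x)) -> (forall m, exists x, f x = m) ->
  right_representation rho.
Proof.
move=> fM fsurj G G0 a; apply: endoP => m.
have [b <-{m}] := fsurj m.
have [n nP] := tsubst_finitely_determined A G.
pose a' i := if i == n then b else a i.
rewrite (nP a a'); last by move=> i lt_in; rewrite /a' ltn_eqF.
have -> : b = nsubst a' (novX F n) by rewrite nsubstX /a' eqxx.
(* The map g |-> f(g(a')) turns right multiplication by v into the action of v(a'); it sends the
   zero vector x_n G to m G(a'). *)
have fh (v g : freeNovikov F) :
    (f \o nsubst a') (rmul v g) = rho (nsubst a' v) ((f \o nsubst a') g).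
  by rewrite /= nsubstM fM.
have /= <- := tlift_intertwine fh G (novX F n).
by rewrite G0 /= !linear0.
Qed.

(** * Two R-identities *)

Section RIdentities.
Variable F : fieldType.

Local Notation X i := (novX F i).
Local Notation R := (@tvec F (freeNovikov F)).

Lemma R_identity_comm : R_identity (R (X 0) ** R (X 1) - R (X 1) ** R (X 0)).
Proof.
rewrite /R_identity linearB /= !tliftM !tlift_vec; apply/eqP.
rewrite subr_eq0; apply/eqP; apply: endoP => g.
exact: namulAC.
Qed.

(** Left symmetry puts g in the middle; in both terms of (xz,g,y), right commutativity then moves z
    to the end. *)
Lemma associator_mulr (A : novikovType F) (g x y z : A) :
  associator g (x ** z) y = associator g x y ** z.
Proof.
rewrite associatorC12 (associatorC12 g) /associator namulBl.
by rewrite (namulAC x z g) (namulAC _ z y) (namulAC x z (g ** y)).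
Qed.

(** At g, the operator R_(xy) - R_x R_y takes the value -(g,x,y), so this is [associator_mulr] in
    operator form. *)
Lemma R_identity_defect : R_identity
  (R ((X 0 ** X 2) ** X 1) - R (X 0 ** X 2) ** R (X 1)
   - (R (X 0 ** X 1) - R (X 0) ** R (X 1)) ** R (X 2)).
Proof.
rewrite /R_identity !linearB /= !tliftM !linearB /= !tliftM !tlift_vec.
apply/eqP; rewrite subr_eq0; apply/eqP; apply: endoP => g.
have := associator_mulr g (X 0) (X 1) (X 2).
by move/(congr1 -%R); rewrite /associator namulBl !opprB -namulBl.
Qed.

End RIdentities.

(** * From almost faithful irreducible modules to primitivity *)

Section RightModules.
Variables (F : fieldType) (A : novikovType F) (M : lmodType F).
Variable rho : {linear A -> endo M}.
Hypothesis rhoR : right_representation rho.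

Lemma rep_comm a b m : rho a (rho b m) = rho b (rho a m).
Proof.
pose s i := nth 0 [:: b; a] i.
have := rhoR (R_identity_comm F) s.
rewrite /tsubst !linearB /= !tliftM !tlift_vec /= !nsubstX.
by move/eqP; rewrite subr_eq0 => /eqP /(congr1 (fun g : endo M => g m)).
Qed.

(** For right multiplication in A this is -(m,x,y). The argument x comes last because the defect is
    used as a linear map from A to M. *)
Definition defect (y : A) (m : M) (x : A) : M :=
  rho (x ** y) m - rho y (rho x m).

Fact defect_linear y m : linear (defect y m).
Proof.
move=> c u v; rewrite /defect namulDl nascaleAl !(linearP rho) /= linearP.
by rewrite scalerBr opprD addrACA.
Qed.

HB.instance Definition _ y m :=
  GRing.isLinear.Build F A M *:%R (defect y m) (defect_linear y m).

Lemma defect_mulr y m x z : defect y m (x ** z) = rho z (defect y m x).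
Proof.
pose s i := nth 0 [:: x; y; z] i.
have := rhoR (R_identity_defect F) s.
rewrite /tsubst !linearB /= !tliftM !linearB /= !tliftM !tlift_vec /=.
rewrite !nsubstM !nsubstX.
move/eqP; rewrite subr_eq0 => /eqP /(congr1 (fun g : endo M => g m)) e.
by rewrite -[RHS]linearB; exact: e.
Qed.


Lemma defect_rep y m x a : defect y (rho a m) x = rho a (defect y m x).
Proof. by rewrite /defect linearB /= !(rep_comm _ a). Qed.

Lemma defectN y m x : defect y (- m) x = - defect y m x.
Proof. by rewrite /defect !(linearN (rho _)) opprD. Qed.

(** Defects are built from operators in the image of rho, which all commute. *)
Lemma defectC y m a b : defect y (defect y m a) b = defect y (defect y m b) a.
Proof.
have defectB u v x : defect y (u - v) x = defect y u x - defect y v x.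
  by rewrite /defect !linearB /= addrACA.
by rewrite [defect y m a]/defect defectB !defect_rep.
Qed.

(** By [defect_mulr] the factors e, y and ey of (a,e,y) act on m B(a,y), where they combine to
    -B(e,y); [defectC] then exchanges a and e. *)
Lemma defect_associator y m a e :
  defect y m (associator a e y) = - defect y (defect y m e) a.
Proof.
rewrite -defectC /associator [LHS]linearB /= !defect_mulr.
by rewrite [in RHS]/defect opprB.
Qed.

Definition orbit (m : M) (x : A) : M := rho x m.

Fact orbit_linear m : linear (orbit m).
Proof. by move=> c u v; rewrite /orbit linearP. Qed.

HB.instance Definition _ m :=
  GRing.isLinear.Build F A M *:%R (orbit m) (orbit_linear m).

Section ModuleMorphism.
Hypotheses (irr : irreducible rho) (faithful : almost_faithful rho).
Variables (phi : {linear A -> M}) (x0 : A).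
Hypotheses (phiM : forall x a, phi (x ** a) = rho a (phi x)).
Hypothesis phi_neq0 : phi x0 <> 0.

Lemma submodule_image (J : set A) : right_ideal J -> submodule rho (phi @` J).
Proof.
case=> -[J0 JP] JM; split; first split.
- by exists 0; rewrite ?linear0.
- move=> c _ _ [x Jx <-] [y Jy <-].
  by exists (c *: x + y); [exact: JP | rewrite linearP].
- by move=> _ a [x Jx <-]; exists (x ** a); [exact: JM | rewrite phiM].
Qed.

Lemma irreducible_surj m : exists x, phi x = m.
Proof.
have [e|e] := irr.1 _ (submodule_image (two_sided_idealT A).1).
  by case: phi_neq0; rewrite -[_ = 0]/([set 0] (phi x0)) -e; exists x0.
have : [set: M] m by [].
by rewrite -e => -[x _ <-]; exists x.
Qed.

Lemma maximal_ker : maximal_right_ideal [set x | phi x = 0].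
Proof.
split.
- split; first split=> [|c x y /= px py]; first exact: linear0.
    by rewrite linearP /= px py scaler0 addr0.
  by move=> x a /= px; rewrite phiM px linear0.
- by move=> e; apply: phi_neq0; rewrite -[_ = 0]/([set x | phi x = 0] x0) e.
move=> J hJ JnT kerJ; have [e|e] := irr.1 _ (submodule_image hJ).
  apply/seteqP; split=> // x Jx.
  by rewrite /= -[_ = 0]/([set 0] (phi x)) -e; exists x.
case: JnT; apply/seteqP; split=> // x _.
(* If J maps onto M, then x differs from an element of J by an element of the kernel, which J
   contains. *)
have : [set: M] (phi x) by [].
rewrite -e => -[y Jy pyx]; rewrite -(subrK y x); apply: (subspaceD hJ.1) => //.
by apply: kerJ; rewrite /= linearB /= pyx subrr.
Qed.

(** Every m is some phi(b), so m rho(a) = phi(ba) with ba in J; thus J acts as zero. *)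
Lemma ideal_in_ker (J : set A) :
  two_sided_ideal J -> J `<=` [set x | phi x = 0] -> J = [set 0].
Proof.
move=> hJ Jker; apply/seteqP; split=> [x Jx|_ ->]; last by case: hJ => -[[]].
rewrite -faithful; exists J; split=> // a Ja; apply: endoP => m.
have [b <-] := irreducible_surj m.
by rewrite -phiM; apply: Jker; case: hJ => _; apply.
Qed.

Lemma primitive_of_modular_ker : modular [set x | phi x = 0] -> primitive A.
Proof.
move=> mod; exists [set x | phi x = 0]; split=> //; first exact: maximal_ker.
exact: ideal_in_ker.
Qed.

End ModuleMorphism.

Lemma irreducible_primitive :
  irreducible rho -> almost_faithful rho -> primitive A.
Proof.
move=> irr faithful.
have [[y [m [x0 x0P]]]|noD] := pselect (exists y m x, defect y m x <> 0).
  apply: (primitive_of_modular_ker irr faithful (defect_mulr y m) x0P).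
  have [ker_ideal ker_proper _] := maximal_ker irr (defect_mulr y m) x0P.
  split=> //; left.
  (* The sign cancels the one in [defect_associator], so (a,e,y) and a have the same image. *)
  have [e eP] := irreducible_surj irr (defect_mulr y m) x0P (- m).
  exists e, y => a; apply/eqP; rewrite linearB subr_eq0 /= defect_associator.
  by move: eP => /= ->; rewrite defectN opprK.
have rhoM x y m : rho (x ** y) m = rho y (rho x m).
  apply/eqP; rewrite -subr_eq0; apply/eqP; apply: contrapT => ne.
  by apply: noD; exists y, m, x.
have [m0 [a0 ma]] := irr.2.
have phiM x a : orbit m0 (x ** a) = rho a (orbit m0 x) by rewrite /orbit rhoM.
apply: (primitive_of_modular_ker irr faithful phiM ma).
have [ker_ideal ker_proper _] := maximal_ker irr phiM ma.
split=> //; right.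
(* Here rho is multiplicative with commuting values, so the kernel is also a left ideal. *)
have phiC x y : orbit m0 (x ** y) = orbit m0 (y ** x).
  by rewrite /orbit !rhoM rep_comm.
have hI : two_sided_ideal [set x | orbit m0 x = 0].
  by split=> // x a /= px; rewrite phiC phiM px linear0.
exists hI; split.
  elim/quotAlg_ind=> x; elim/quotAlg_ind=> y; rewrite -!qclassM.
  by apply/qclassP; rewrite /= linearB /= phiC subrr.
(* An element that fixes m0 becomes the unit of the quotient. *)
have [e eP] := irreducible_surj irr phiM ma m0.
exists (qclass hI e); elim/quotAlg_ind=> x; rewrite -!qclassM.
have ex : orbit m0 (e ** x) = orbit m0 x by rewrite phiM eP.
by split; apply/qclassP; rewrite /= linearB /= ?(phiC x) ex subrr.
Qed.

End RightModules.

(** * The right module A/P *)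

Section RightQuotient.
Variables (F : fieldType).

(* For the zero product every subspace is a two-sided ideal, which makes the  *)
(* quotient algebra construction available for a right ideal of A.            *)
Definition zero_product (V : lmodType F) : Type := V.

HB.instance Definition _ (V : lmodType F) := GRing.Lmodule.on (zero_product V).

Section ZeroProduct.
Variable V : lmodType F.
Let mul (_ _ : zero_product V) : zero_product V := 0.
Fact zero_productDl : left_distributive mul +%R.
Proof. by move=> *; rewrite /mul addr0. Qed.
Fact zero_productDr : right_distributive mul +%R.
Proof. by move=> *; rewrite /mul addr0. Qed.
Fact zero_productZl c x y : mul (c *: x) y = c *: mul x y.
Proof. by rewrite /mul scaler0. Qed.
Fact zero_productZr c x y : mul x (c *: y) = c *: mul x y.
Proof. by rewrite /mul scaler0. Qed.
HB.instance Definition _ := Lmodule_isNaAlgebra.Build F (zero_product V)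
  zero_productDl zero_productDr zero_productZl zero_productZr.
End ZeroProduct.

Fact zero_product_ideal (V : lmodType F) (P : set V) :
  subspace P -> @two_sided_ideal F (zero_product V) P.
Proof. by move=> hP; split=> [|x a _]; [split=> // x a _ |]; case: hP. Qed.

Variables (A : novikovType F) (P : set A).
Hypothesis hP : right_ideal P.

Definition quotMod : lmodType F := quotAlg (zero_product_ideal hP.1).

Definition qproj (x : A) : quotMod := qclass (zero_product_ideal hP.1) x.

Fact qproj_linear : linear qproj.
Proof. by move=> c x y; rewrite /qproj qclassD qclassZ. Qed.

HB.instance Definition _ :=
  GRing.isLinear.Build F A quotMod *:%R qproj qproj_linear.

Lemma qprojP x y : P (x - y) <-> qproj x = qproj y.
Proof. exact: (qclassP (zero_product_ideal hP.1)). Qed.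

Lemma qproj0P x : P x <-> qproj x = 0.
Proof. by rewrite -(linear0 qproj) -qprojP subr0. Qed.

Lemma qproj_surj u : exists x, qproj x = u.
Proof. by exists (repr u); apply: qclass_repr. Qed.

Definition qact_fun (a : A) (u : quotMod) : quotMod :=
  qproj ((repr u : A) ** a).

Lemma qact_funE a x : qact_fun a (qproj x) = qproj (x ** a).
Proof.
apply/qprojP; rewrite -namulBl; apply: hP.2.
by apply/qprojP; apply: qclass_repr.
Qed.

Fact qact_fun_linear a : linear (qact_fun a).
Proof.
move=> c u v; have [x <-] := qproj_surj u; have [y <-] := qproj_surj v.
by rewrite -linearP !qact_funE namulDl nascaleAl linearP.
Qed.

HB.instance Definition _ a :=
  GRing.isLinear.Build F quotMod quotMod *:%R (qact_fun a) (qact_fun_linear a).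

Definition qact (a : A) : endo quotMod := qact_fun a.

Fact qact_linear : linear qact.
Proof.
move=> c a b; apply: endoP => u; have [x <-] := qproj_surj u.
by rewrite /= !qact_funE namulDr nascaleAr linearP.
Qed.

HB.instance Definition _ :=
  GRing.isLinear.Build F A (endo quotMod) *:%R qact qact_linear.

Lemma qactE a x : qact a (qproj x) = qproj (x ** a).
Proof. exact: qact_funE. Qed.

Lemma qact_right_representation : right_representation qact.
Proof.
apply: (@right_representation_image _ _ _ qact qproj); last exact: qproj_surj.
by move=> x a; rewrite /= qactE.
Qed.

End RightQuotient.

(** * Consequences of a maximal modular right ideal with zero core *)

Section Primitive.
Variables (F : fieldType) (A : novikovType F) (P : set A).
Hypotheses (hP : right_ideal P) (maxP : maximal_right_ideal P).
Hypothesis modP : modular P.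
Hypothesis coreP : forall J, two_sided_ideal J -> J `<=` P -> J = [set 0].

Lemma mul_ideal_modular (J : set A) :
  two_sided_ideal J -> (forall a x, J x -> P (a ** x)) -> J = [set 0].
Proof.
move=> hJ AJ; apply: coreP => // x Jx.
have [_ _ [[e [f efP]]|[hI [_ [u uP]]]]] := modP.
  rewrite -(subrK (associator x e f) x); apply: (subspaceD hP.1) => //.
  (* In (e,x,f) = (ex)f - e(xf), both ex and e(xf) lie in AJ, hence in P. *)
  rewrite associatorC12; apply: (subspaceB hP.1); first exact/hP.2/AJ.
  by apply: AJ; case: hJ => -[_ +] _; apply.
have [e ue] : exists e, qclass hI e = u by exists (repr u); apply: qclass_repr.
have [+ _] := uP (qclass hI x); rewrite -ue -qclassM => /esym e_eq.
have xP := (qclassP hI _ _).2 e_eq.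
by rewrite -(subrK (e ** x) x); apply: (subspaceD hP.1) => //; apply: AJ.
Qed.

Lemma qact_irreducible : irreducible (qact hP).
Proof.
have [_ PnT maxPJ] := maxP; split.
  move=> N [[N0 NP] NM].
  (* The preimage of N is a right ideal containing P, so maximality applies to it. *)
  pose J := [set x | N (qproj hP x)].
  have hJ : right_ideal J.
    split; first split=> [|c x y Jx Jy]; rewrite /J /= ?linear0 ?linearP //=.
      exact: NP.
    by move=> x a Jx; rewrite /J /= -qactE; apply: NM.
  have PJ : P `<=` J by move=> x /(qproj0P hP) Px; rewrite /J /= Px.
  have [JT|JnT] := pselect (J = setT).
    right; apply/seteqP; split=> // u _; have [x <-] := @qproj_surj _ _ _ hP u.
    by have : J x by rewrite JT.
  left; have JeP := maxPJ J hJ JnT PJ; apply/seteqP; split=> [u Nu|_ -> //].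
  have [x xu] := @qproj_surj _ _ _ hP u.
  by rewrite /= -xu; apply/(qproj0P hP); rewrite -JeP /J /= xu.
(* A zero action means AA <= P; then A = 0 by [mul_ideal_modular], and P would be all of A. *)
apply: contrapT => act0; apply: PnT.
have T0 : [set: A] = [set 0].
  apply: (mul_ideal_modular (two_sided_idealT A)) => a x _; apply/(qproj0P hP).
  rewrite -qactE; apply: contrapT => ne; apply: act0.
  by exists (qproj hP a), x.
apply/seteqP; split=> // x; rewrite T0 => ->; exact: hP.1.1.
Qed.

(** An ideal J acting as zero on A/P satisfies AJ <= P. *)
Lemma qact_almost_faithful : almost_faithful (qact hP).
Proof.
apply/seteqP; split=> [x [J [hJ Jker Jx]]|_ ->].
  suff <- : J = [set 0] by [].
  apply: mul_ideal_modular => // a y Jy; apply/(qproj0P hP).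
  by rewrite -qactE (Jker _ Jy).
by case: (quasikernel_ideal (qact hP)) => -[[[]]].
Qed.

Lemma maximal_modular_prime : prime_algebra A.
Proof.
move=> I J hI hJ IJ0; have [IP|InP] := pselect (I `<=` P).
  by left; apply: coreP.
right; have [_ _ maxPJ] := maxP; apply: mul_ideal_modular => // a x Jx.
pose S := [set u + v | u in I & v in P].
have S_ideal : right_ideal S.
  have [[[I0 IZD] IM] _] := hI; have [[P0 PZD] PM] := hP.
  split; first split.
  - by exists 0 => //; exists 0 => //; rewrite addr0.
  - move=> c _ _ [u Iu [v Pv <-]] [u' Iu' [v' Pv' <-]].
    exists (c *: u + u'); first exact: IZD.
    by exists (c *: v + v'); [exact: PZD | rewrite scalerDr addrACA].
  - move=> _ b [u Iu [v Pv <-]]; exists (u ** b); first exact: IM.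
    by exists (v ** b); [exact: PM | rewrite namulDl].
have PS : P `<=` S.
  move=> v Pv; exists 0; first by case: hI => -[[]].
  by exists v => //; rewrite add0r.
have [ST|SnT] := pselect (S = setT); last first.
  case: InP => u Iu; rewrite -(maxPJ S S_ideal SnT PS).
  by exists u => //; exists 0; [case: hP => -[] | rewrite addr0].
(* With a = u + v, u in I and v in P, the product ax reduces to vx, which lies in P. *)
have : S a by rewrite ST.
case=> u Iu [v Pv <-]; rewrite namulDl IJ0 // add0r.
exact: hP.2.
Qed.

End Primitive.

Theorem lemma5p1 (F : fieldType) (hF : 2%N \notin [pchar F])
    (A : novikovType F) :
  ((exists (M : lmodType F) (rho : {linear A -> endo M}),
      [/\ right_representation rho, irreducible rho & almost_faithful rho])
   <-> primitive A)
  /\ (primitive A -> prime_algebra A).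
Proof.
split; last first.
  case=> P [maxP modP coreP]; have [hP _ _] := maxP.
  exact: maximal_modular_prime hP maxP modP coreP.
split=> [[M [rho [rhoR irr faithful]]]|[P [maxP modP coreP]]].
  exact: irreducible_primitive rhoR irr faithful.
have [hP _ _] := maxP; exists (quotMod hP), (qact hP); split.
- exact: qact_right_representation.
- exact: qact_irreducible maxP modP coreP.
- exact: qact_almost_faithful modP coreP.
Qed.
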